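(* Let $\mathcal{P}$ be a finite 2-dimensional poset and let $\sigma,\overline{\sigma}$ be a diametral pair of linear extensions of $\mathcal{P}$. Then $L_\sigma,L_{\overline{\sigma}}$ is a diametral pair of linear extensions of the downset lattice $\mathcal{D}_\mathcal{P}$.
   Context: $\mathcal{P}$ is 2-dimensional if it has a realizer $\{L_1,L_2\}$: two linear extensions whose common comparabilities are exactly those of $\mathcal{P}$. $\mathcal{D}_\mathcal{P}$ is the poset of downsets of $\mathcal{P}$ ordered by inclusion. For a linear extension $\sigma$ of $\mathcal{P}$, $L_\sigma$ is the linear order on downsets with $A^{\downarrow}<B^{\downarrow}$ iff $\max_\sigma(A\triangle B)\in B$, where $A,B$ are the antichains of maximal elements and $\max_\sigma S$ is the $\sigma$-largest element of $S$. The distance between two linear extensions is the number of unordered pairs appearing in different orders in them; a diametral pair is a pair of linear extensions of maximum distance. *)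

(* Defs.v *)
From HB Require Import structures.
From mathcomp Require Import all_boot all_order.

Set Implicit Arguments.
Unset Strict Implicit.
Unset Printing Implicit Defensive.

(* Linear orders are represented by their reflexive relation [L : rel T]. *)
Definition linear_extension (d : Order.disp_t) (T : porderType d)
    (L : rel T) : Prop :=
  [/\ total L, antisymmetric L, transitive L &
      forall x y : T, (x <= y)%O -> L x y].

Definition realizer2 (d : Order.disp_t) (T : porderType d)
    (L1 L2 : rel T) : Prop :=
  [/\ linear_extension L1, linear_extension L2 &
      forall x y : T, (x <= y)%O = L1 x y && L2 x y].

(* [L1] and [L2] may coincide, so chains are included. *)
Definition two_dimensional (d : Order.disp_t) (T : porderType d) : Prop :=
  exists L1 L2 : rel T, realizer2 L1 L2.

Definition reversed_pairs (T : finType) (L1 L2 : rel T) : {set {set T}} :=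
  [set [set p.1; p.2] |
    p in [set p : T * T | [&& p.1 != p.2, L1 p.1 p.2 & L2 p.2 p.1]]].

Definition linext_dist (T : finType) (L1 L2 : rel T) : nat :=
  #|reversed_pairs L1 L2|.

Definition diametral_pair (d : Order.disp_t) (T : finPOrderType d)
    (L1 L2 : rel T) : Prop :=
  [/\ linear_extension L1, linear_extension L2 &
      forall M1 M2 : rel T, linear_extension M1 -> linear_extension M2 ->
        linext_dist M1 M2 <= linext_dist L1 L2].

Definition is_downset (d : Order.disp_t) (T : finPOrderType d) (D : {set T}) :
    bool :=
  [forall x in D, forall y : T, (y <= x)%O ==> (y \in D)].

Record downset (d : Order.disp_t) (T : finPOrderType d) := Downset {
  downset_set :> {set T};
  downsetP : is_downset downset_set
}.

HB.instance Definition _ (d : Order.disp_t) (T : finPOrderType d) :=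
  [isSub for @downset_set d T].
HB.instance Definition _ (d : Order.disp_t) (T : finPOrderType d) :=
  [Finite of downset T by <:].

Definition downset_le (d : Order.disp_t) (T : finPOrderType d) : rel (downset T) :=
  fun D E => (D : {set T}) \subset (E : {set T}).

Lemma downset_le_refl (d : Order.disp_t) (T : finPOrderType d) :
  reflexive (@downset_le d T).
Proof. by move=> D; exact: subxx. Qed.

Lemma downset_le_anti (d : Order.disp_t) (T : finPOrderType d) :
  antisymmetric (@downset_le d T).
Proof. by move=> D E H; apply/val_inj/eqP; rewrite eqEsubset. Qed.

Lemma downset_le_trans (d : Order.disp_t) (T : finPOrderType d) :
  transitive (@downset_le d T).
Proof. by move=> D E F; exact: subset_trans. Qed.

HB.instance Definition _ (d : Order.disp_t) (T : finPOrderType d) :=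
  Order.Le_isPOrder.Build Order.SetSubsetOrder.subset_display (downset T)
    (@downset_le_refl d T) (@downset_le_anti d T) (@downset_le_trans d T).

Definition maximals (d : Order.disp_t) (T : finPOrderType d) (D : {set T}) :
    {set T} :=
  [set x in D | [forall y in D, ~~ (x < y)%O]].

Definition symdiff (T : finType) (A B : {set T}) : {set T} :=
  (A :\: B) :|: (B :\: A).

(* [None] exactly when [S] is empty, provided [s] is a linear order. *)
Definition max_wrt (T : finType) (s : rel T) (S : {set T}) : option T :=
  [pick x in S | [forall y in S, s y x]].

Definition downset_linext_lt (d : Order.disp_t) (T : finPOrderType d)
    (s : rel T) : rel (downset T) :=
  fun D E =>
    if max_wrt s (symdiff (maximals D) (maximals E)) is Some x
    then x \in maximals E else false.

Definition downset_linext (d : Order.disp_t) (T : finPOrderType d)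
    (s : rel T) : rel (downset T) :=
  fun D E => (D == E) || downset_linext_lt s D E.

(* Main.v *)
Require Import Defs.
From HB Require Import structures.
From mathcomp Require Import all_boot all_order.
From mathcomp Require Import zify.

Import Order.POrderTheory.

Set Implicit Arguments.
Unset Strict Implicit.
Unset Printing Implicit Defensive.

(* A diametral pair [s], [t] of a 2-dimensional poset reverses every
   incomparable pair, hence is a realizer.  The order [L_s] compares two
   downsets [D], [E] by the [s]-largest element of their symmetric difference
   [S].  Group the pairs [(D, E)] by their meet and join: the members of a
   group correspond to the sets [X = D :\: E], which range over the unions of
   connected components of the comparability graph on [S].  For a linear
   extension [M] of the downset lattice, the [X] with [D] before [E] in [M]
   form a down-closed family that contains exactly one of [X] and [S :\: X].
   By Kleitman's inequality two such families share at least a quarter of all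
   [X], so two linear extensions differ on at most a quarter.  For [L_s] and
   [L_t] the families consist of the [X] avoiding the [s]-maximum and the
   [t]-maximum of [S]; these lie in different components when [S] is
   disconnected, so exactly a quarter is reversed. *)

Lemma card_setI_swapped (T : finType) (A F : {set T}) (f : T -> T) :
    {in A &, injective f} -> {in A, forall x, f x \in A} ->
    {in A, forall x, (f x \in F) = (x \notin F)} ->
  #|A :&: F|.*2 = #|A|.
Proof.
move=> injf fA fF; rewrite -(cardsID F A) -addnn; congr (_ + _).
have leq_imset (B C : {set T}) :
    B \subset A -> {in B, forall x, f x \in C} -> #|B| <= #|C|.
  move=> /subsetP BA BC; rewrite -(card_in_imset (sub_in2 BA injf)).
  by apply/subset_leq_card/subsetP=> _ /imsetP[x xB ->]; apply: BC.
apply/eqP; rewrite eqn_leq !leq_imset ?subsetIl ?subsetDl // => x.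
  by rewrite !inE => /andP[xF xA]; rewrite fA // fF.
by rewrite !inE => /andP[xA xF]; rewrite fA // fF // xF.
Qed.

Lemma chebyshev_sum2 (m1 m2 n1 n2 : nat) :
  m2 <= m1 -> n2 <= n1 -> (m1 + m2) * (n1 + n2) <= (m1 * n1 + m2 * n2).*2.
Proof. by move=> /subnK <- /subnK <-; nia. Qed.

Lemma leq_card_fibres (T U : finType) (f : T -> U) (A B : {set T}) :
    {in A, forall x,
      #|[set y in A | f y == f x]| <= #|[set y in B | f y == f x]|} ->
  #|A| <= #|B|.
Proof.
move=> le_fibres.
rewrite -!sum1_card !(partition_big f predT) //=; apply: leq_sum => c _.
rewrite !sum1dep_card.
have [-> //|[x]] := set_0Vmem [set y in A | f y == c]; first by rewrite cards0.
by rewrite inE => /andP[xA /eqP <-]; apply: le_fibres.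
Qed.

Lemma in_symdiff (T : finType) (A B : {set T}) x :
  (x \in symdiff A B) = (x \in A) (+) (x \in B).
Proof. by rewrite !inE; case: (x \in A); case: (x \in B). Qed.

Lemma symdiffC (T : finType) : commutative (@symdiff T).
Proof. by move=> A B; rewrite /symdiff setUC. Qed.

Lemma symdiffK (T : finType) (C : {set T}) :
  involutive (fun A : {set T} => symdiff A C).
Proof. by move=> A; apply/setP=> x; rewrite !in_symdiff addbK. Qed.

Lemma symdiffE (T : finType) (A B : {set T}) :
  symdiff A B = (A :|: B) :\: (A :&: B).
Proof. by rewrite setDUl !setDIr !setDv set0U setU0. Qed.

Lemma symdiff_eq0 (T : finType) (A B : {set T}) :
  (symdiff A B == set0) = (A == B).
Proof. by rewrite /symdiff setU_eq0 !setD_eq0 eqEsubset. Qed.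

Definition set_ring (T : finType) (B : {set {set T}}) : Prop :=
  {in B &, forall X Y, X :|: Y \in B /\ X :\: Y \in B}.

Definition closed_below (T : finType) (B F : {set {set T}}) : Prop :=
  {in B &, forall X Y : {set T}, X \subset Y -> Y \in F -> X \in F}.

Definition self_complementary (T : finType) (B F : {set {set T}})
    (S : {set T}) : Prop :=
  {in B, forall X, (S :\: X \in F) = (X \notin F)}.

Definition set_ring_atom (T : finType) (B : {set {set T}}) (a : {set T}) :
    Prop :=
  [/\ a \in B, a != set0 &
      {in B, forall X : {set T}, [disjoint a & X] \/ a \subset X}].

Section SetRing.
Variables (T : finType) (B : {set {set T}}).
Hypothesis ringB : set_ring B.

Lemma set_ringU : {in B &, forall X Y, X :|: Y \in B}.
Proof. by move=> X Y BX BY; case: (ringB BX BY). Qed.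

Lemma set_ringD : {in B &, forall X Y, X :\: Y \in B}.
Proof. by move=> X Y BX BY; case: (ringB BX BY). Qed.

Lemma set_ringI : {in B &, forall X Y, X :&: Y \in B}.
Proof.
move=> X Y BX BY; have <- : X :\: (X :\: Y) = X :&: Y.
  by rewrite setDDr setDv set0U.
by rewrite !set_ringD.
Qed.

Lemma set_ring_symdiff : {in B &, forall X Y, symdiff X Y \in B}.
Proof. by move=> X Y BX BY; rewrite set_ringU ?set_ringD. Qed.

Lemma set_ring_atom_exists X :
  X \in B -> X != set0 -> exists a, set_ring_atom B a.
Proof.
move=> BX nzX.
case: (@arg_minnP _ X (fun Y => (Y \in B) && (Y != set0)) (fun Y => #|Y|)).
  by rewrite BX.
move=> a /andP[Ba nza] min_a; exists a; split=> // Y BY.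
have [aY|nz_aY] := eqVneq (a :&: Y) set0.
  by left; rewrite -setI_eq0 aY.
right; apply/setIidPl/eqP; rewrite eqEcard subsetIl min_a //.
by rewrite set_ringI.
Qed.

(* Toggling the points of [X0], which does not affect [x], halves the sets
   without [x] according to whether they contain [y]. *)
Lemma card_set_ring_separated S X0 x y :
    S \in B -> x \in S -> X0 \in B -> x \notin X0 -> y \in X0 ->
  4 * #|[set X in B | (x \notin X) && (y \in X)]| = #|B|.
Proof.
move=> BS xS BX0 xX0 yX0.
have injC C : injective (fun X : {set T} => symdiff X C).
  exact: inv_inj (symdiffK C).
pose Bx := [set X in B | x \notin X].
have half_x : #|Bx|.*2 = #|B|.
  rewrite /Bx setIdE; apply: card_setI_swapped (in2W (injC S)) _ _ => X BX.
    exact: set_ring_symdiff.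
  by rewrite [LHS]in_set [in RHS]in_set in_symdiff xS addbT.
have half_y : #|Bx :&: [set X : {set T} | y \in X]|.*2 = #|Bx|.
  apply: card_setI_swapped (in2W (injC X0)) _ _ => X.
    case/setIdP=> BX xX; apply/setIdP; split; first exact: set_ring_symdiff.
    by rewrite in_symdiff (negPf xX) (negPf xX0).
  by rewrite [LHS]in_set [in RHS]in_set in_symdiff yX0 addbT.
rewrite -half_x -half_y -!mul2n mulnA; congr (_ * _).
by apply: eq_card => X; rewrite !inE andbA.
Qed.

End SetRing.

Definition lower_slice (T : finType) (a : {set T}) (F : {set {set T}}) :
    {set {set T}} :=
  [set X in F | [disjoint a & X]].

Definition upper_slice (T : finType) (B : {set {set T}}) (a : {set T})
    (F : {set {set T}}) : {set {set T}} :=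
  [set X in lower_slice a B | a :|: X \in F].

Section AtomSplitting.
Variables (T : finType) (B : {set {set T}}) (a : {set T}).
Hypotheses (ringB : set_ring B) (atom_a : set_ring_atom B a).
Implicit Types (F G : {set {set T}}) (X Y : {set T}).

Lemma lower_slice_ring : set_ring (lower_slice a B).
Proof.
move=> X Y; rewrite !inE -!setI_eq0.
move=> /andP[BX /eqP aX] /andP[BY /eqP aY].
by rewrite set_ringU ?set_ringD // setIUr setIDA aX aY setU0 set0D eqxx.
Qed.

Lemma lower_slice_proper : lower_slice a B \proper B.
Proof.
have [Ba nza _] := atom_a; apply/properP; split.
  by apply/subsetP=> X /setIdP[].
by exists a; rewrite // inE Ba -setI_eq0 setIid.
Qed.

Lemma setU_atom_in X : X \in lower_slice a B -> a :|: X \in B.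
Proof. by have [Ba _ _] := atom_a; case/setIdP=> BX _; apply: set_ringU. Qed.

Lemma lower_slice_sub F :
  F \subset B -> lower_slice a F \subset lower_slice a B.
Proof. by move=> FB; rewrite /lower_slice !setIdE setSI. Qed.

Lemma upper_slice_sub F : upper_slice B a F \subset lower_slice a B.
Proof. by apply/subsetP=> X /setIdP[]. Qed.

Lemma upper_slice_full : upper_slice B a B = lower_slice a B.
Proof.
apply/setP=> X; rewrite in_set andb_idr // => BX; exact: setU_atom_in.
Qed.

Lemma card_slices F :
  F \subset B -> #|lower_slice a F| + #|upper_slice B a F| = #|F|.
Proof.
move=> /subsetP FB; have [Ba nza atomB] := atom_a.
rewrite -[RHS](cardsID [set X : {set T} | [disjoint a & X]]) -setIdE.
congr (_ + _).
have injU : {in upper_slice B a F &, injective (setU a)}.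
  move=> X Y /setIdP[/setIdP[_ aX] _] /setIdP[/setIdP[_ aY] _] eqU.
  have drop_a (Z : {set T}) : [disjoint a & Z] -> (a :|: Z) :\: a = Z.
    by rewrite disjoint_sym setDUl setDv set0U => /setDidPl.
  by rewrite -(drop_a X aX) eqU drop_a.
rewrite -(card_in_imset injU); apply: eq_card => X; apply/imsetP/setDP.
  move=> [Y /setIdP[_ FY] ->]; split=> //.
  by rewrite inE -setI_eq0 setIC setUK.
move=> [FX]; rewrite inE => aX; have BX := FB X FX.
have sub_aX : a \subset X.
  by have [disj|//] := atomB X BX; rewrite disj in aX.
have eqX : a :|: X :\: a = X by rewrite -{1}(setIidPr sub_aX) setID.
exists (X :\: a); last by rewrite eqX.
rewrite !inE eqX FX set_ringD //=.
by rewrite -setI_eq0 setIDA setDIl setDv set0I eqxx.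
Qed.

Lemma lower_slice_closed_below F :
  closed_below B F -> closed_below (lower_slice a B) (lower_slice a F).
Proof.
move=> clF X Y /setIdP[BX aX] /setIdP[BY _] XY /setIdP[FY _].
by rewrite inE aX (clF X Y).
Qed.

Lemma upper_slice_closed_below F :
  closed_below B F -> closed_below (lower_slice a B) (upper_slice B a F).
Proof.
move=> clF X Y B0X B0Y XY /setIdP[_ FY]; rewrite in_set B0X /=.
by apply: clF FY; rewrite ?setU_atom_in ?setUS.
Qed.

Lemma upper_slice_sub_lower F :
  closed_below B F -> upper_slice B a F \subset lower_slice a F.
Proof.
move=> clF; apply/subsetP=> X /setIdP[B0X FX]; have /setIdP[BX aX] := B0X.
by rewrite inE aX andbT; apply: clF FX; rewrite ?setU_atom_in ?subsetUr.
Qed.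

Lemma lower_sliceI F G :
  lower_slice a (F :&: G) = lower_slice a F :&: lower_slice a G.
Proof. by rewrite /lower_slice !setIdE setIIl. Qed.

Lemma upper_sliceI F G :
  upper_slice B a (F :&: G) = upper_slice B a F :&: upper_slice B a G.
Proof.
by apply/setP=> X; rewrite !inE [RHS]andbACA andbb.
Qed.

(* The two slices combine by Chebyshev's sum inequality because the upper ones
   are the smaller ones. *)
Lemma kleitman_of_slices F G :
    F \subset B -> G \subset B -> closed_below B F -> closed_below B G ->
    #|lower_slice a F| * #|lower_slice a G| <=
      #|lower_slice a B| * #|lower_slice a (F :&: G)| ->
    #|upper_slice B a F| * #|upper_slice B a G| <=
      #|lower_slice a B| * #|upper_slice B a (F :&: G)| ->
  #|F| * #|G| <= #|B| * #|F :&: G|.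
Proof.
move=> FB GB clF clG lower_ineq upper_ineq.
have FGB : F :&: G \subset B by rewrite subIset ?FB.
rewrite -(card_slices FB) -(card_slices GB) -(card_slices FGB).
rewrite -(card_slices (subxx B)) upper_slice_full addnn -doubleMl.
apply: leq_trans (chebyshev_sum2 _ _) _.
- exact/subset_leq_card/upper_slice_sub_lower.
- exact/subset_leq_card/upper_slice_sub_lower.
- by rewrite mulnDr leq_double leq_add.
Qed.

End AtomSplitting.

Lemma kleitman_inequality (T : finType) (B F G : {set {set T}}) :
    set_ring B -> F \subset B -> G \subset B ->
    closed_below B F -> closed_below B G ->
  #|F| * #|G| <= #|B| * #|F :&: G|.
Proof.
have [n] := ubnP #|B|; elim: n => // n IHn in B F G *.
rewrite ltnS => leBn ringB FB GB clF clG.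
have [sub0|] := boolP (B \subset [set set0]).
  have := subset_trans FB sub0; rewrite subset1 => /orP[]/eqP eqF; last first.
    by rewrite eqF cards0.
  have := subset_trans GB sub0; rewrite subset1 => /orP[]/eqP eqG; last first.
    by rewrite eqG cards0 muln0.
  rewrite eqF eqG setIid cards1 !muln1; apply/card_gt0P; exists set0.
  by rewrite (subsetP FB) // eqF set11.
case/subsetPn=> X BX; rewrite inE => nzX.
have [a atom_a] := set_ring_atom_exists ringB BX nzX.
have IH (F' G' : {set {set T}}) :
    F' \subset lower_slice a B -> G' \subset lower_slice a B ->
    closed_below (lower_slice a B) F' -> closed_below (lower_slice a B) G' ->
  #|F'| * #|G'| <= #|lower_slice a B| * #|F' :&: G'|.
  apply: IHn (lower_slice_ring ringB); apply: leq_trans leBn.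
  exact/proper_card/lower_slice_proper.
apply: (kleitman_of_slices ringB atom_a) => //.
  by rewrite lower_sliceI IH ?lower_slice_sub //;
    apply: lower_slice_closed_below.
by rewrite upper_sliceI IH ?upper_slice_sub //;
  apply: upper_slice_closed_below.
Qed.

Section SelfComplementary.
Variables (T : finType) (B : {set {set T}}) (S : {set T}).
Hypotheses (ringB : set_ring B) (BS : S \in B).
Hypothesis subS : {in B, forall X : {set T}, X \subset S}.
Implicit Types F G : {set {set T}}.

Lemma card_self_complementary F :
  F \subset B -> self_complementary B F S -> #|F|.*2 = #|B|.
Proof.
move=> FB compF; rewrite -(setIidPr FB).
apply: (card_setI_swapped (f := setD S)) => // [X Y BX BY|X BX]; last first.
  exact: set_ringD.
move/(congr1 (setD S)); rewrite !setDDr !setDv !set0U.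
by rewrite (setIidPr (subS BX)) (setIidPr (subS BY)).
Qed.

Lemma card_self_complementary_setD F G :
    F \subset B -> G \subset B -> closed_below B F -> closed_below B G ->
    self_complementary B F S -> self_complementary B G S ->
  4 * #|F :\: G| <= #|B|.
Proof.
move=> FB GB clF clG compF compG.
have cardF := card_self_complementary FB compF.
have cardG := card_self_complementary GB compG.
have B_gt0 : 0 < #|B| by apply/card_gt0P; exists S.
have G_gt0 : 0 < #|G| by rewrite -double_gt0 cardG.
have : #|G| <= #|F :&: G|.*2.
  rewrite -(leq_pmul2l G_gt0) -doubleMr doubleMl cardG.
  by rewrite -{1}(double_inj (etrans cardF (esym cardG))) kleitman_inequality.
have := cardsID G F; lia.
Qed.

End SelfComplementary.

Definition greatest (T : finType) (s : rel T) (S : {set T}) (x : T) : Prop :=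
  x \in S /\ {in S, forall y, s y x}.

Lemma greatest_exists (T : finType) (s : rel T) (S : {set T}) :
  total s -> transitive s -> S != set0 -> exists x, greatest s S x.
Proof.
move=> tot tr /set0Pn[x0 x0S].
pose s_rev : rel T := fun x y => s y x.
have refl : reflexive s_rev by move=> x; have := tot x x; rewrite orbb.
have trans : transitive s_rev by move=> y x z sxy szx; apply: tr szx sxy.
have total : total s_rev by move=> x y; apply: tot.
case: (@extremumP _ _ _ x0 (mem S) id refl trans total x0S) => x xS max_x.
by exists x.
Qed.

Lemma max_wrt_greatest (T : finType) (s : rel T) (S : {set T}) x :
  antisymmetric s -> greatest s S x -> max_wrt s S = Some x.
Proof.
move=> anti [xS max_x]; rewrite /max_wrt.
case: pickP => [y /andP[yS /forall_inP max_y]|/(_ x)].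
  by congr Some; apply: anti; rewrite max_x ?max_y.
by rewrite xS => /forall_inP[].
Qed.

Section Realizers.
Variables (d : Order.disp_t) (P : porderType d).
Implicit Types (L s t : rel P) (x y : P).

Lemma linear_extension_swap L x y :
  linear_extension L -> x != y -> L y x = ~~ L x y.
Proof.
case=> tot anti _ _ neq; have [xy|nxy] := boolP (L x y).
  by apply: contraNF neq => yx; apply/eqP/anti; rewrite xy.
by have := tot x y; rewrite (negPf nxy).
Qed.

Lemma incomparable_neq x y : (x >< y)%O -> x != y.
Proof. by apply: contraNneq => ->; apply: comparablexx. Qed.

Lemma realizer_comparable s t x y :
  realizer2 s t -> x != y -> (x >=< y)%O = (s x y == t x y).
Proof.
case=> lins lint rel_st neq; rewrite /Order.comparable !rel_st.
rewrite (linear_extension_swap lins neq) (linear_extension_swap lint neq).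
by case: (s x y); case: (t x y).
Qed.

Lemma realizer_incomparable s t x y :
  realizer2 s t -> (x >< y)%O -> t x y = ~~ s x y.
Proof.
move=> real inc; have neq := incomparable_neq inc.
move: inc; rewrite (realizer_comparable real neq).
by case: (s x y); case: (t x y).
Qed.

End Realizers.

Definition inversions (T : finType) (L1 L2 : rel T) : {set T * T} :=
  [set p : T * T | [&& p.1 != p.2, L1 p.1 p.2 & L2 p.2 p.1]].

Lemma linext_distE (T : finType) (L1 L2 : rel T) :
  antisymmetric L1 -> linext_dist L1 L2 = #|inversions L1 L2|.
Proof.
move=> anti; apply: card_in_imset => -[a b] [u v]; rewrite !inE /=.
move=> /and3P[neq_ab ab _] /and3P[_ uv _] eq_sets.
have /set2P a_uv : a \in [set u; v] by rewrite -eq_sets set21.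
have /set2P b_uv : b \in [set u; v] by rewrite -eq_sets set22.
case: a_uv b_uv neq_ab ab => [] -> [] -> //; rewrite ?eqxx // => neq vu.
by rewrite (anti u v) ?eqxx ?uv // in neq.
Qed.

Section LinearExtensions.
Variables (d : Order.disp_t) (P : finPOrderType d).
Implicit Types L s t : rel P.

Lemma inversion_incomparable L1 L2 p :
    linear_extension L1 -> linear_extension L2 -> p \in inversions L1 L2 ->
  (p.1 >< p.2)%O.
Proof.
move=> lin1 lin2; rewrite inE => /and3P[neq L12 L21].
have [_ _ _ ext1] := lin1; have [_ _ _ ext2] := lin2.
apply/negP=> /orP[/ext2|/ext1]; apply/negP.
  by rewrite -linear_extension_swap.
by rewrite linear_extension_swap ?negbK.
Qed.

Definition incomparable_pairs : {set P * P} := [set p : P * P | (p.1 >< p.2)%O].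

Lemma card_oriented_incomparable_pairs L :
    linear_extension L ->
  #|incomparable_pairs :&: [set p | L p.1 p.2]|.*2 = #|incomparable_pairs|.
Proof.
move=> linL; apply: (card_setI_swapped (f := fun p => (p.2, p.1))).
- by move=> [x y] [u v] _ _ [-> ->].
- by move=> p; rewrite !inE comparable_sym.
move=> p; rewrite !inE => /incomparable_neq neq.
exact: linear_extension_swap.
Qed.

Lemma diametral_realizer s t :
  two_dimensional P -> diametral_pair s t -> realizer2 s t.
Proof.
move=> [L1 [L2 real]] [lins lint diam].
have [lin1 lin2 _] := real; have [_ antis _ exts] := lins.
have [_ anti1 _ _] := lin1.
pose oriented L := incomparable_pairs :&: [set p | L p.1 p.2].
have inversions_oriented : inversions s t \subset oriented s.
  apply/subsetP=> p inv; rewrite !inE (inversion_incomparable lins lint inv).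
  by move: inv; rewrite inE => /and3P[].
have oriented_inversions : oriented L1 \subset inversions L1 L2.
  apply/subsetP=> p; rewrite !inE => /andP[inc L1p].
  have neq := incomparable_neq inc; rewrite neq L1p /=.
  by rewrite (linear_extension_swap lin2) // (realizer_incomparable real) ?L1p.
have eq_card_oriented : #|oriented s| = #|oriented L1|.
  by apply: double_inj; rewrite !card_oriented_incomparable_pairs.
have /setP mem_inversions : inversions s t = oriented s.
  apply/eqP; rewrite eqEcard inversions_oriented eq_card_oriented.
  apply: leq_trans (subset_leq_card oriented_inversions) _.
  by rewrite -!linext_distE // diam.
split=> // x y; apply/idP/andP=> [xy|[sxy txy]].
  by have [_ _ _ extt] := lint; rewrite exts ?extt.
have [->|neq] := eqVneq x y; first exact: lexx.
have := mem_inversions (x, y); rewrite !inE /= neq sxy.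
rewrite (linear_extension_swap lint neq) txy andbT.
move=> /esym/negbFE/orP[//|/exts].
by rewrite (linear_extension_swap lins neq) sxy.
Qed.

End LinearExtensions.

Lemma downset_closed (d : Order.disp_t) (P : finPOrderType d) (D : downset P)
    (x y : P) :
  x \in (D : {set P}) -> (y <= x)%O -> y \in (D : {set P}).
Proof.
move=> xD; have /forall_inP/(_ x xD)/forallP/(_ y)/implyP := downsetP D.
exact.
Qed.

Section DownsetOrder.
Variables (d : Order.disp_t) (P : finPOrderType d) (s : rel P).
Hypothesis lins : linear_extension s.
Implicit Types (D E F : downset P) (x y z : P).

Lemma greatest_symdiff_exists D E :
  D != E -> exists x, greatest s (symdiff D E) x.
Proof.
by case: lins => tot _ tr _ neq; apply: greatest_exists; rewrite ?symdiff_eq0.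
Qed.

Lemma greatest_symdiffC D E x :
  greatest s (symdiff D E) x -> greatest s (symdiff E D) x.
Proof. by rewrite symdiffC. Qed.

Lemma greatest_symdiff_in D E x :
    greatest s (symdiff D E) x ->
  (x \in (D : {set P})) = (x \notin (E : {set P})).
Proof. by case; rewrite in_symdiff; case: (x \in _); case: (x \in _). Qed.

Lemma greatest_symdiff_maximal D E x :
    greatest s (symdiff D E) x -> (x \in maximals D) = (x \in (D : {set P})).
Proof.
have [_ anti _ ext] := lins; move=> gr_x; have [_ max_x] := gr_x.
rewrite inE andb_idr // => xD; have xE := xD.
rewrite (greatest_symdiff_in gr_x) in xE.
apply/forall_inP=> y yD; apply/negP=> lt_xy; have le_xy := ltW lt_xy.
have yE : y \notin (E : {set P}).
  by apply: contra xE => yE; apply: downset_closed yE le_xy.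
suff eq_xy : x = y by rewrite eq_xy ltxx in lt_xy.
by apply: anti; rewrite ext //= max_x // in_symdiff yD (negPf yE).
Qed.

Lemma greatest_symdiff_bound D E x y :
    greatest s (symdiff D E) x -> y \in maximals D -> y \notin maximals E ->
  s y x.
Proof.
have [_ _ tr ext] := lins; move=> [_ max_x]; rewrite inE => /andP[yD max_y].
have [yE|yE] := boolP (y \in (E : {set P})); last first.
  by move=> _; apply: max_x; rewrite in_symdiff yD (negPf yE).
rewrite inE yE => /forall_inPn[z zE]; rewrite negbK => lt_yz.
have zD : z \notin (D : {set P}).
  by apply: contraL lt_yz => zD; apply: (forall_inP max_y).
apply: tr (ext _ _ (ltW lt_yz)) (max_x z _).
by rewrite in_symdiff zE (negPf zD).
Qed.

Lemma greatest_symdiff_maximals D E x :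
    greatest s (symdiff D E) x ->
  greatest s (symdiff (maximals D) (maximals E)) x.
Proof.
move=> gr_x; have gr_x' := greatest_symdiffC gr_x; split=> [|y].
  rewrite in_symdiff (greatest_symdiff_maximal gr_x).
  by rewrite (greatest_symdiff_maximal gr_x') -in_symdiff; case: gr_x.
rewrite in_symdiff; case yD: (y \in maximals D) => yE.
  exact: greatest_symdiff_bound gr_x yD yE.
exact: greatest_symdiff_bound gr_x' yE (negbT yD).
Qed.

Lemma downset_linextE D E x :
    greatest s (symdiff D E) x ->
  downset_linext s D E = (x \in (E : {set P})).
Proof.
have [_ anti _ _] := lins; move=> gr_x.
have neq : D != E.
  by case: gr_x => + _; apply: contraTneq => ->; rewrite in_symdiff addbb.
rewrite /downset_linext /downset_linext_lt (negPf neq).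
rewrite (max_wrt_greatest anti (greatest_symdiff_maximals gr_x)).
exact: greatest_symdiff_maximal (greatest_symdiffC gr_x).
Qed.

Lemma downset_linext_swap D E :
  D != E -> downset_linext s E D = ~~ downset_linext s D E.
Proof.
move=> /greatest_symdiff_exists[x gr_x].
rewrite (downset_linextE gr_x) (downset_linextE (greatest_symdiffC gr_x)).
exact: greatest_symdiff_in gr_x.
Qed.

Lemma downset_linextP D E :
  reflect (D = E \/ exists x, greatest s (symdiff D E) x /\ x \in (E : {set P}))
          (downset_linext s D E).
Proof.
apply: (iffP idP) => [DE|[->|[x [gr_x xE]]]].
- have [->|neq] := eqVneq D E; [by left | right].
  have [x gr_x] := greatest_symdiff_exists neq.
  by exists x; rewrite -(downset_linextE gr_x).
- by rewrite /downset_linext eqxx.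
- by rewrite (downset_linextE gr_x).
Qed.

Lemma greatest_symdiff_trans D E F x y :
    greatest s (symdiff D E) x -> greatest s (symdiff E F) y ->
    x != y -> s x y ->
  greatest s (symdiff D F) y.
Proof.
have [_ anti tr _] := lins; move=> [_ max_x] [yEF max_y] neq xy.
have in_symdiffDF z :
    (z \in symdiff D F) = (z \in symdiff D E) (+) (z \in symdiff E F).
  by rewrite !in_symdiff addbA addbK.
have yDE : y \notin symdiff D E.
  by apply: contra neq => yDE; apply/eqP/anti; rewrite xy max_x.
split=> [|z]; rewrite in_symdiffDF; first by rewrite (negPf yDE) yEF.
case zDE: (z \in symdiff D E) => zEF; last exact: max_y.
exact: tr (max_x z zDE) xy.
Qed.

Lemma downset_linext_trans : transitive (downset_linext s).
Proof.
have [tot _ _ _] := lins.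
move=> E D F /downset_linextP[-> //|[x [gr_x xE]]].
move=> /downset_linextP[<-|[y [gr_y yF]]].
  by apply/downset_linextP; right; exists x.
have yE : y \notin (E : {set P}) by rewrite (greatest_symdiff_in gr_y) negbK.
have neq : x != y by apply: contraNneq yE => <-.
apply/downset_linextP; right; case/orP: (tot x y) => [xy|yx].
  by exists y; split=> //; apply: greatest_symdiff_trans gr_x gr_y neq xy.
have gr_xDF : greatest s (symdiff D F) x.
  apply: greatest_symdiffC; rewrite eq_sym in neq.
  exact: greatest_symdiff_trans (greatest_symdiffC gr_y)
    (greatest_symdiffC gr_x) neq yx.
exists x; split=> //; rewrite -[_ \in _]negbK -(greatest_symdiff_in gr_xDF).
by rewrite (greatest_symdiff_in gr_x) negbK.
Qed.

Lemma downset_linext_linear : linear_extension (downset_linext s).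
Proof.
split.
- move=> D E; have [->|neq] := eqVneq D E.
    by rewrite /downset_linext eqxx.
  by rewrite (downset_linext_swap neq) orbN.
- move=> D E; apply: contraTeq => neq.
  by rewrite (downset_linext_swap neq) andbN.
- exact: downset_linext_trans.
- move=> D E leDE; have [->|neq] := eqVneq D E.
    by rewrite /downset_linext eqxx.
  have [x gr_x] := greatest_symdiff_exists neq.
  rewrite (downset_linextE gr_x); apply: contraT => xE; have xD := xE.
  rewrite -(greatest_symdiff_in gr_x) in xD.
  by rewrite (subsetP (leDE : (D : {set P}) \subset E)) in xE.
Qed.

End DownsetOrder.

(* The unions of connected components of the comparability graph on [S]. *)
Definition detached (d : Order.disp_t) (P : finPOrderType d) (S : {set P}) :
    {set {set P}} :=
  [set X : {set P} | (X \subset S) &&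
    [forall x in X, forall y in S, (x >=< y)%O ==> (y \in X)]].

Section Detached.
Variables (d : Order.disp_t) (P : finPOrderType d).
Implicit Types (S X : {set P}) (x y z : P).

Lemma detachedP S X :
  reflect (X \subset S /\ {in X & S, forall x y, (x >=< y)%O -> y \in X})
          (X \in detached S).
Proof.
rewrite inE; apply: (iffP andP) => -[sub clX]; split=> //.
  move=> x y xX yS; apply/implyP.
  by have /forall_inP := forall_inP clX x xX; apply.
by apply/forall_inP=> x xX; apply/forall_inP=> y yS; apply/implyP/clX.
Qed.

Lemma detached_sub S : {in detached S, forall X, X \subset S}.
Proof. by move=> X /detachedP[]. Qed.

Lemma detached_closed S X x y :
  X \in detached S -> x \in X -> y \in S -> (x >=< y)%O -> y \in X.
Proof. by case/detachedP=> _; apply. Qed.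

Lemma detached_full S : S \in detached S.
Proof. by apply/detachedP; split. Qed.

Lemma detached_ring S : set_ring (detached S).
Proof.
move=> X Y detX detY; split; apply/detachedP; split.
- by rewrite subUset !detached_sub.
- move=> x y /setUP[xX|xY] yS xy; apply/setUP.
    by left; apply: detached_closed detX xX yS xy.
  by right; apply: detached_closed detY xY yS xy.
- exact: subset_trans (subsetDl X Y) (detached_sub detX).
move=> x y /setDP[xX xY] yS xy; rewrite inE (detached_closed detX xX) // andbT.
apply: contra xY => yY; apply: detached_closed detY yY _ _.
  exact: (subsetP (detached_sub detX)).
by rewrite comparable_sym.
Qed.

Lemma detachedC S X : X \in detached S -> S :\: X \in detached S.
Proof.
by move=> detX; rewrite (set_ringD (@detached_ring S)) ?detached_full.
Qed.

Lemma detached_incomparable S W x z :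
  W \in detached S -> x \in S :\: W -> z \in W -> (x >< z)%O.
Proof.
move=> detW /setDP[xS xW] zW; apply: contra xW => xz.
by apply: detached_closed detW zW xS _; rewrite comparable_sym.
Qed.

(* In the planar picture of the realizer, the points of [S] outside [W] lie
   either to the upper left or to the lower right of [z], and no comparability
   joins the two sides. *)
Lemma detached_left_part s t S W z :
    realizer2 s t -> W \in detached S -> z \in W ->
  [set x in S :\: W | s x z] \in detached S.
Proof.
move=> real detW zW; have [lins lint _] := real.
have [_ _ trs _] := lins; have [_ _ trt _] := lint.
apply/detachedP; split; first by apply/subsetP=> x /setIdP[/setDP[]].
move=> x y /setIdP[xCW xz] yS xy.
have yCW := detached_closed (detachedC detW) xCW yS xy.
have inc_x := detached_incomparable detW xCW zW.
have inc_y := detached_incomparable detW yCW zW.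
rewrite inE yCW /=; apply: contraT => nyz.
have zy : s z y.
  by rewrite (linear_extension_swap lins (incomparable_neq inc_y)).
have s_xy := trs _ _ _ xz zy.
have t_yx : t y x.
  apply: (trt z); first by rewrite (realizer_incomparable real inc_y).
  rewrite (linear_extension_swap lint (incomparable_neq inc_x)).
  by rewrite (realizer_incomparable real inc_x) xz.
have neq : x != y by apply: contraNneq nyz => <-.
move: xy; rewrite (realizer_comparable real neq) s_xy.
by rewrite -(negbK (t x y)) -(linear_extension_swap lint neq) t_yx.
Qed.

Lemma detached_separates_greatest s t S W x y :
    realizer2 s t -> greatest s S x -> greatest t S y ->
    W \in detached S -> W != set0 -> W != S ->
  exists X, [/\ X \in detached S, x \notin X & y \in X].
Proof.
move=> real [xS max_x] [yS max_y] detW nzW neqW.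
have [lins lint _] := real; have [_ antis _ _] := lins.
have separates V z : V \in detached S -> z \in V -> x \notin V -> y \notin V ->
    exists X, [/\ X \in detached S, x \notin X & y \in X].
  move=> detV zV xV yV; have zS := subsetP (detached_sub detV) z zV.
  have yCV : y \in S :\: V by rewrite inE yV.
  exists [set u in S :\: V | s u z]; split.
  - exact: detached_left_part real detV zV.
  - rewrite inE; apply: contra xV => /andP[_ xz].
    by rewrite (antis x z) // xz max_x.
  - have inc := detached_incomparable detV yCV zV.
    rewrite inE yCV -[s y z]negbK -(realizer_incomparable real inc).
    by rewrite -(linear_extension_swap lint) ?max_y // incomparable_neq.
have [xW|xW] := boolP (x \in W); have [yW|yW] := boolP (y \in W).
- have /set0Pn[z zCW] : S :\: W != set0.
    rewrite setD_eq0; apply: contra neqW.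
    by rewrite eqEsubset (detached_sub detW).
  by apply: separates (detachedC detW) zCW _ _; rewrite inE ?xW ?yW.
- by exists (S :\: W); rewrite detachedC // !inE xW yW.
- by exists W.
- by have /set0Pn[z zW] := nzW; apply: separates detW zW xW yW.
Qed.

End Detached.

Definition meet_join (d : Order.disp_t) (P : finPOrderType d)
    (p : downset P * downset P) : {set P} * {set P} :=
  ((p.1 : {set P}) :&: p.2, (p.1 : {set P}) :|: p.2).

(* The junk value [D] if [D :&: E :|: X] is not a downset. *)
Definition meet_adjoin (d : Order.disp_t) (P : finPOrderType d)
    (D E : downset P) (X : {set P}) : downset P :=
  insubd D ((D : {set P}) :&: E :|: X).

Section MeetJoinFibre.
Variables (d : Order.disp_t) (P : finPOrderType d).
Implicit Types (D E : downset P) (p q : downset P * downset P).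

Lemma meet_join_symdiff p q :
  meet_join p = meet_join q -> symdiff p.1 p.2 = symdiff q.1 q.2.
Proof. by rewrite !symdiffE => -[-> ->]. Qed.

Lemma setD_detached D E : (D : {set P}) :\: E \in detached (symdiff D E).
Proof.
apply/detachedP; split; first exact: subsetUl.
move=> x y /setDP[xD xE] yS /orP[le_xy|le_yx].
  have yE : y \notin (E : {set P}).
    by apply: contra xE => yE; apply: downset_closed yE le_xy.
  by move: yS; rewrite in_symdiff inE (negPf yE) addbF.
by move: yS; rewrite in_symdiff inE (downset_closed xD le_yx) andbT.
Qed.

Variables D0 E0 : downset P.
Let S := symdiff D0 E0.
Implicit Types X Y : {set P}.

Definition fibre_pair X : downset P * downset P :=
  (meet_adjoin D0 E0 X, meet_adjoin D0 E0 (S :\: X)).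

Lemma meet_adjoinE X : X \in detached S ->
  meet_adjoin D0 E0 X = (D0 : {set P}) :&: E0 :|: X :> {set P}.
Proof.
move=> detX; rewrite -[LHS]/(val (meet_adjoin D0 E0 X)) insubdK // unfold_in.
apply/forall_inP=> x xIX; apply/forallP=> y; apply/implyP=> le_yx.
have [yS|yS] := boolP (y \in S).
  case/setUP: xIX => [/setIP[xD xE]|xX].
    by move: yS; rewrite in_symdiff !(downset_closed _ le_yx).
  apply/setUP; right; apply: detached_closed detX xX yS _.
  by rewrite /Order.comparable le_yx orbT.
have x_join : x \in (D0 : {set P}) :|: E0.
  case/setUP: xIX => [/setIP[xD _]|/(subsetP (detached_sub detX))].
    by rewrite inE xD.
  by rewrite /S symdiffE => /setDP[].
have y_join : y \in (D0 : {set P}) :|: E0.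
  by case/setUP: x_join => /downset_closed/(_ le_yx) yDE; rewrite inE yDE ?orbT.
by apply/setUP; left; move: yS; rewrite /S symdiffE inE y_join andbT negbK.
Qed.

Lemma meet_adjoin_le X Y :
    X \in detached S -> Y \in detached S -> X \subset Y ->
  (meet_adjoin D0 E0 X <= meet_adjoin D0 E0 Y)%O.
Proof.
move=> detX detY XY.
by rewrite -[(_ <= _)%O]/(_ \subset _) !meet_adjoinE // setUS.
Qed.

Lemma fibre_pair_setD X : X \in detached S ->
  ((fibre_pair X).1 : {set P}) :\: (fibre_pair X).2 = X.
Proof.
move=> detX; rewrite !meet_adjoinE ?detachedC //; apply/setP=> x.
have := subsetP (detached_sub detX) x; rewrite in_symdiff !inE.
by case: (x \in X) => [/(_ isT)|_]; case: (x \in _); case: (x \in _).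
Qed.

Lemma meet_join_fibre_pair X : X \in detached S ->
  meet_join (fibre_pair X) = meet_join (D0, E0).
Proof.
move=> detX; rewrite /meet_join /= !meet_adjoinE ?detachedC //.
by congr (_, _); apply/setP=> x; have := subsetP (detached_sub detX) x;
  rewrite in_symdiff !inE;
  case: (x \in X) => [/(_ isT)|_]; case: (x \in _); case: (x \in _).
Qed.

Lemma fibre_pairK p : meet_join p = meet_join (D0, E0) ->
  ((p.1 : {set P}) :\: p.2 \in detached S) /\
  fibre_pair ((p.1 : {set P}) :\: p.2) = p.
Proof.
case: p => D E eq_mj; have eqS : symdiff D E = S := meet_join_symdiff eq_mj.
have detX : (D : {set P}) :\: E \in detached S by rewrite -eqS setD_detached.
split=> //; case: eq_mj => eqI _.
congr (_, _); apply/val_inj; rewrite /= meet_adjoinE ?detachedC // -eqI.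
  by apply/setP=> x; rewrite !inE; case: (x \in _); case: (x \in _).
by rewrite -eqS; apply/setP=> x; rewrite !inE; case: (x \in _); case: (x \in _).
Qed.

Lemma card_meet_join_fibre (A : {set downset P * downset P}) :
  #|[set p in A | meet_join p == meet_join (D0, E0)]| =
  #|[set X in detached S | fibre_pair X \in A]|.
Proof.
rewrite -[RHS](card_in_imset (f := fibre_pair)); last first.
  move=> X Y /setIdP[detX _] /setIdP[detY _] eq_XY.
  by rewrite -(fibre_pair_setD detX) eq_XY fibre_pair_setD.
apply: eq_card => p; apply/setIdP/imsetP => [[pA /eqP/fibre_pairK[detX eqp]]|].
  exists ((p.1 : {set P}) :\: p.2); last by rewrite eqp.
  by apply/setIdP; rewrite eqp.
by case=> X /setIdP[detX XA] ->; rewrite meet_join_fibre_pair.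
Qed.

Hypothesis neq : D0 != E0.

Lemma fibre_pair_neq X :
  X \in detached S -> (fibre_pair X).1 != (fibre_pair X).2.
Proof.
move=> /meet_join_fibre_pair/meet_join_symdiff eqS.
by rewrite -val_eqE -symdiff_eq0 eqS symdiff_eq0.
Qed.

Definition ahead (M : rel (downset P)) : {set {set P}} :=
  [set X in detached S | M (fibre_pair X).1 (fibre_pair X).2].

Lemma in_ahead M X : (X \in ahead M) =
  (X \in detached S) && M (fibre_pair X).1 (fibre_pair X).2.
Proof. exact: in_set. Qed.

Lemma ahead_sub M : ahead M \subset detached S.
Proof. by apply/subsetP=> X /setIdP[]. Qed.

Lemma ahead_closed_below M :
  linear_extension M -> closed_below (detached S) (ahead M).
Proof.
move=> [_ _ tr ext] X Y detX detY XY; rewrite !in_ahead detX detY /= => aheadY.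
apply: (tr (fibre_pair Y).1); first exact/ext/meet_adjoin_le.
apply: tr aheadY _; apply/ext/meet_adjoin_le; rewrite ?detachedC //.
exact: setDS.
Qed.

Lemma ahead_self_complementary M :
  linear_extension M -> self_complementary (detached S) (ahead M) S.
Proof.
move=> linM X detX; rewrite !in_ahead detachedC // detX /=.
rewrite setDDr setDv set0U (setIidPr (detached_sub detX)).
exact: linear_extension_swap (fibre_pair_neq detX).
Qed.

Lemma card_inversions_fibre M1 M2 :
    linear_extension M2 ->
  #|[set p in inversions M1 M2 | meet_join p == meet_join (D0, E0)]| =
  #|ahead M1 :\: ahead M2|.
Proof.
move=> lin2; rewrite card_meet_join_fibre; apply: eq_card => X.
rewrite [LHS]in_set [RHS]in_setD !in_ahead.
have [detX|] := boolP (X \in detached S); rewrite ?andbF //= in_set.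
have neqX := fibre_pair_neq detX.
by rewrite (linear_extension_swap lin2 neqX) neqX andTb andbC.
Qed.

Lemma leq_card_ahead_setD M1 M2 :
    linear_extension M1 -> linear_extension M2 ->
  4 * #|ahead M1 :\: ahead M2| <= #|detached S|.
Proof.
move=> lin1 lin2.
apply: (card_self_complementary_setD (@detached_ring _ _ S) (detached_full S));
  rewrite ?ahead_sub //.
- exact: detached_sub.
- exact: ahead_closed_below.
- exact: ahead_closed_below.
- exact: ahead_self_complementary.
- exact: ahead_self_complementary.
Qed.

Lemma in_ahead_downset_linext s x X :
    linear_extension s -> greatest s S x -> X \in detached S ->
  (X \in ahead (downset_linext s)) = (x \notin X).
Proof.
move=> lins gr_x detX; rewrite in_ahead detX andTb.
have eqS := meet_join_symdiff (meet_join_fibre_pair detX).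
rewrite (@downset_linextE _ _ _ lins _ _ x); last by rewrite eqS.
have [xS _] := gr_x.
rewrite /= meet_adjoinE ?detachedC // in_setU in_setD in_setI xS andbT.
by move: xS; rewrite in_symdiff; case: (x \in _); case: (x \in _).
Qed.

End MeetJoinFibre.

Lemma card_ahead_realizer (d : Order.disp_t) (P : finPOrderType d) (s t : rel P)
    (D E : downset P) :
    realizer2 s t -> (D >< E)%O ->
  4 * #|ahead D E (downset_linext s) :\: ahead D E (downset_linext t)| =
    #|detached (symdiff D E)|.
Proof.
move=> real inc; have [lins lint _] := real; have neq := incomparable_neq inc.
have [x gr_x] := greatest_symdiff_exists lins neq.
have [y gr_y] := greatest_symdiff_exists lint neq.
have /norP[nDE nED] := inc.
have nz_DE : (D : {set P}) :\: E != set0 by rewrite setD_eq0.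
have neq_DE : (D : {set P}) :\: E != symdiff D E.
  apply: contra nED => /eqP eqS; apply/subsetP=> z zE.
  by have /setP/(_ z) := eqS; rewrite in_symdiff inE zE addbT => /esym/negbFE.
have [X [detX xX yX]] := detached_separates_greatest real gr_x gr_y
  (setD_detached D E) nz_DE neq_DE.
have [xS _] := gr_x.
rewrite -(card_set_ring_separated (@detached_ring _ _ _) (detached_full _) xS
  detX xX yX).
congr (4 * _); apply: eq_card => Y; rewrite in_setD [RHS]in_set.
have [detY|/negPf ndetY] := boolP (Y \in detached (symdiff D E)).
  rewrite (in_ahead_downset_linext lins gr_x detY).
  by rewrite (in_ahead_downset_linext lint gr_y detY) negbK andTb andbC.
by rewrite !in_ahead ndetY.
Qed.

Theorem theorem4 (d : Order.disp_t) (P : finPOrderType d) (s sbar : rel P)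
    (dim2 : two_dimensional P) (diam : diametral_pair s sbar) :
  diametral_pair (downset_linext s) (downset_linext sbar).
Proof.
have real := diametral_realizer dim2 diam; have [lins lint _] := real.
have linLs := downset_linext_linear lins.
have linLt := downset_linext_linear lint.
split; [exact: linLs | exact: linLt | move=> M1 M2 lin1 lin2].
have [_ anti1 _ _] := lin1; have [_ antiLs _ _] := linLs.
rewrite (linext_distE M2 anti1) (linext_distE _ antiLs).
apply: (leq_card_fibres (f := @meet_join d P)) => -[D E] inv.
have inc := inversion_incomparable lin1 lin2 inv.
have neq := incomparable_neq inc.
rewrite [leqLHS](card_inversions_fibre neq M1 lin2).
rewrite [leqRHS](card_inversions_fibre neq _ linLt).
rewrite -(leq_pmul2l (isT : 0 < 4)) (card_ahead_realizer real inc).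
exact: leq_card_ahead_setD.
Qed.
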